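(* Let $q$ be a prime power with $q\equiv 1 \pmod 4$ and $q>2809$, and let $n=1+\frac{q-1}{2}$. Then there exists an element of $\mathbb{F}_q$ that cannot be written as $\alpha+\beta$ with $\alpha\in C_5$ and $\beta\in C_n$.
   Context: For a prime power $q$ and an integer $k>1$, an element $a\in\mathbb{F}_q$ is called a $k$-potent if $a^k=a$, and $C_k$ denotes the set of all $k$-potents in $\mathbb{F}_q$. For $q\equiv 1\pmod 4$ one has $C_5=\{0,\pm1,\pm\zeta\}$ with $\zeta^2=-1$. For $n=1+(q-1)/2$, $C_n$ is the set of squares in $\mathbb{F}_q$, including $0$. *)

(* Defs.v *)
From mathcomp Require Import all_boot all_order all_algebra all_field.
Set Implicit Arguments. Unset Strict Implicit. Unset Printing Implicit Defensive.
Import GRing.Theory.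
Local Open Scope ring_scope.

Definition kpotent (F : finFieldType) (k : nat) (a : F) : bool := a ^+ k == a.

Definition Cpot (F : finFieldType) (k : nat) : {set F} := [set a : F | kpotent k a].

(* Main.v *)
Require Import Defs.
From mathcomp Require Import all_boot all_order all_algebra all_field.
From mathcomp Require Import zify ring.
Set Implicit Arguments. Unset Strict Implicit. Unset Printing Implicit Defensive.
Import Order.TTheory GRing.Theory Num.Theory.
Local Open Scope ring_scope.

(* Let chi be the quadratic character and z^2 = -1. An element x is not a sum as
   soon as chi(x - a) = -1 for the five points a in {0, 1, -1, z, -z}, so it is
   enough that the sum over x of the product of the factors 1 - chi(x - a) exceeds
   80, the most that the five points themselves can contribute.

   Expanding, the sums over three and four points reduce by affine maps and
   x -> 1/x to A = sum chi(x^3 - x) and B = sum chi(x(x - 1)(x - z)); the signs are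
   such that B survives with a coefficient of absolute value 4 only and A with
   coefficient 1 in absolute value. The sum is thus
   q - 15 - (+-A) - (+-4B) - S with S = sum chi(x^5 - x).

   Weil's theorem is not needed. The sums A and S have the form
   sum chi(x(x^m - c)); their second moment over c gives |A| <= 2 sqrt q and
   |S| <= 4 sqrt q. For B, the fourth moment over all polynomials of degree at most
   3 is at most 3q^6 because values at up to four points are independent, and
   q(q - 1)^2 of these polynomials are obtained from x(x - 1)(x - z) by scaling and
   affine substitution, which preserves |B|; hence (q - 1)^2 B^4 <= 3 q^5. *)

(** * Quadratic character and pair correlations *)

Section QuadraticCharacter.

Variable F : finFieldType.
Hypothesis q1mod4 : (#|F| %% 4 = 1)%N.

(** Euler's criterion serves as the definition; integer values let character sums be compared with
    powers of [#|F|]. *)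
Definition chi (x : F) : int :=
  if x == 0 then 0 else if x ^+ (#|F| - 1)./2 == 1 then 1 else -1.

Lemma card_half : ((#|F| - 1)./2 = #|F| %/ 4 * 2)%N.
Proof.
have := divn_eq #|F| 4; rewrite q1mod4 => {1}->.
by rewrite addnK -[4%N]/(2 * 2)%N mulnA -divn2 mulnK.
Qed.

Lemma card_gt3 : (3 < #|F|)%N.
Proof. by have := finNzRing_gt1 F; move: q1mod4; case: #|F| => [|[|[|[|]]]]. Qed.

Lemma chi0 : chi 0 = 0.
Proof. by rewrite /chi eqxx. Qed.

Lemma chi1 : chi 1 = 1.
Proof. by rewrite /chi oner_eq0 expr1n eqxx. Qed.

Lemma expf_half (x : F) : x != 0 ->
  x ^+ (#|F| - 1)./2 = 1 \/ x ^+ (#|F| - 1)./2 = -1.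
Proof.
move=> x0; have : (x ^+ (#|F| - 1)./2) ^+ 2 = 1.
  rewrite -exprM; have -> : ((#|F| - 1)./2 * 2 = #|F|.-1)%N by lia.
  apply: (mulfI x0); rewrite -exprS mulr1.
  have -> : #|F|.-1.+1 = #|F| by lia.
  exact: expf_card.
by move/eqP; rewrite sqrf_eq1 => /orP[] /eqP; [left|right].
Qed.

(** Translation by 1 permutes [F], so adding 1 to every element leaves the sum of all elements
    unchanged. *)
Lemma natr_card : #|F|%:R = 0 :> F.
Proof.
have : \sum_(x : F) x = \sum_(x : F) (x + 1).
  by rewrite (reindex_inj (addIr 1)).
rewrite big_split /= sumr_const -[X in X = _]addr0.
by move/addrI.
Qed.

Lemma natf2_neq0 : 2%:R != 0 :> F.
Proof.
apply/eqP => h2; have := natr_card.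
have -> : #|F| = (2 * (#|F| %/ 2) + 1)%N by lia.
by rewrite natrD natrM h2 mul0r add0r => /eqP; rewrite oner_eq0.
Qed.

Lemma oner_neqN1 : (1 : F) != -1.
Proof. by rewrite -subr_eq0 opprK; exact: natf2_neq0. Qed.

Lemma chiM x y : chi (x * y) = chi x * chi y.
Proof.
rewrite /chi mulf_eq0; case: (eqVneq x 0) => [|x0] /=; first by rewrite mul0r.
case: (eqVneq y 0) => [|y0] /=; first by rewrite mulr0.
have N1 : (-1 == 1 :> F) = false by rewrite eq_sym (negbTE oner_neqN1).
by rewrite exprMn; case: (expf_half x0) => ->; case: (expf_half y0) => ->;
  rewrite ?mulrNN ?mulr1 ?mul1r ?eqxx ?N1.
Qed.

Lemma chi_sqr x : chi x ^+ 2 = (x != 0)%:R.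
Proof. by rewrite /chi; case: (x == 0) => //; case: ifP. Qed.

Lemma chi_sqrM x y : x != 0 -> chi (x ^+ 2 * y) = chi y.
Proof. by move=> x0; rewrite chiM expr2 chiM -expr2 chi_sqr x0 mul1r. Qed.

Lemma chi_pm x : x != 0 -> chi x = 1 \/ chi x = -1.
Proof. by rewrite /chi => /negbTE ->; case: ifP; [left|right]. Qed.

Lemma normr_chi_le1 x : `|chi x| <= 1.
Proof. by rewrite /chi; do 2 case: ifP => //. Qed.

Lemma chiV x : chi x^-1 = chi x.
Proof.
have [->|x0] := eqVneq x 0; first by rewrite invr0.
have : chi x * chi x^-1 = 1 by rewrite -chiM mulfV // chi1.
by case: (chi_pm x0) => -> ; lia.
Qed.

(** As 4 divides q - 1, the exponent (q - 1)/2 is even, so -1 is a square. *)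
Lemma chiN x : chi (- x) = chi x.
Proof.
rewrite -mulN1r chiM /chi oppr_eq0 oner_eq0.
by rewrite card_half mulnC exprM sqrrN expr1n expr1n eqxx mul1r.
Qed.

(** Otherwise all q - 1 nonzero elements would be roots of X^((q-1)/2) - 1. *)
Lemma exists_nonsquare : exists2 u : F, u != 0 & chi u = -1.
Proof.
set h := (#|F| - 1)./2.
have h0 : (0 < h)%N by have := card_gt3; rewrite /h; lia.
case: (pickP (fun u : F => (u != 0) && (chi u == -1))) => [u /andP[u0 /eqP]|H].
  by exists u.
have : (size (enum [set~ 0%R : F]) <= h)%N.
  apply: max_unity_roots (enum_uniq _) => //.
  apply/allP => u; rewrite mem_enum !inE => u0; rewrite unity_rootE.
  by have := H u; rewrite u0 /chi (negbTE u0) /= -/h; case: ifP.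
rewrite -cardE cardsC1 /h.
suff H' n : (3 < n -> n.-1 <= (n - 1)./2 -> False)%N by move/(H' _ card_gt3).
lia.
Qed.

Lemma exists_sqrtN1 : exists z : F, z ^+ 2 = -1.
Proof.
have [u u0] := exists_nonsquare.
rewrite /chi (negbTE u0); case: ifP => // /eqP hu _.
exists (u ^+ (#|F| %/ 4)); rewrite -exprM -card_half.
by case: (expf_half u0).
Qed.

Lemma sum_chi : \sum_x chi x = 0.
Proof.
have [u u0 chiu] := exists_nonsquare.
have bu : bijective (fun x : F => u * x).
  by exists (fun x => u^-1 * x) => x; rewrite mulrA ?mulVf ?mulfV ?mul1r.
have : \sum_x chi x = - \sum_x chi x.
  rewrite {1}(reindex (fun x : F => u * x)) /=; last exact: onW_bij.
  by rewrite -sumrN; apply: eq_bigr => x _; rewrite chiM chiu mulN1r.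
lia.
Qed.

Lemma reindex_affine (k s : F) (f : F -> int) : k != 0 ->
  \sum_x f x = \sum_x f (k * x + s).
Proof.
by move=> k0; rewrite (reindex_inj (addIr s)) (reindex_inj (mulfI k0)).
Qed.

(** For distinct [a] and [b], shifting [a] to 0 and dividing by the square x^2 leaves chi(1 - c/x),
    where 1 - c/x takes every value except 1; [sum_chi] then gives -chi(1). *)
Lemma sum_chi_pair (a b : F) :
  \sum_x chi ((x - a) * (x - b)) = (a == b)%:R * (#|F|)%:R - 1.
Proof.
rewrite (@reindex_affine 1 a) ?oner_eq0 //.
have [<-|ab] := eqVneq a b.
  rewrite (bigD1 0) //= mulr0 add0r subrr mul0r chi0 add0r mul1r.
  rewrite (eq_bigr (fun=> 1)) => [|x x0]; last first.
    by rewrite mul1r addrK -expr2 [X in chi X]expr2 chiM -expr2 chi_sqr x0.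
  rewrite sumr_const cardC1.
  by rewrite -{2}(prednK (ltnW (ltnW (ltnW card_gt3)))) -natr1 addrK.
rewrite mul0r sub0r.
have [c bE] : exists c, b = a + c by exists (b - a); rewrite addrC subrK.
have c0 : c != 0 by apply: contraNneq ab => c0; rewrite bE c0 addr0.
rewrite {}bE {ab}.
rewrite (bigD1 0) //= mulr0 add0r subrr mul0r chi0 add0r.
rewrite (eq_bigr (fun x => chi (1 - c * x^-1))) => [|x x0]; last first.
  have -> : (1 * x + a - a) * (1 * x + a - (a + c)) = x * x * (1 - c / x).
    by field.
  by rewrite chiM [chi (x * x)]chiM -expr2 chi_sqr x0 mul1r.
have -> : \sum_(x | x != 0) chi (1 - c / x) = \sum_(u | u != 1) chi u.
  rewrite [RHS](reindex_onto (fun x => 1 - c / x) (fun u => c / (1 - u))).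
    apply: eq_bigl => x; apply/idP/andP => [x0|[]]; last first.
      by move=> + _; apply: contraNneq => ->; rewrite invr0 mulr0 subr0.
    split; last by rewrite opprB addrC subrK invf_div mulrCA mulfV ?mulr1.
    by rewrite -subr_eq0 addrAC subrr sub0r oppr_eq0 mulf_neq0 ?invr_eq0.
  move=> u u1; have : 1 - u != 0 by rewrite subr_eq0 eq_sym.
  by move=> ?; field; apply/andP.
by have := sum_chi; rewrite (bigD1 1) //= chi1 addrC => /eqP; rewrite addr_eq0 => /eqP.
Qed.

Lemma card_expf_eq (m : nat) (c : F) : (0 < m)%N ->
  (#|[set y : F | y ^+ m == c]| <= m)%N.
Proof.
move=> m0; rewrite cardE -ltnS -(size_XnsubC c m0).
apply: max_poly_roots (enum_uniq _); first by rewrite -size_poly_eq0 size_XnsubC.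
apply/allP => y; rewrite mem_enum inE => /eqP <-.
by rewrite rootE !hornerE subrr.
Qed.

(** * Second moment over c of the sums of chi(x(x^m - c)) *)

Definition chi_sum (m : nat) (c : F) : int := \sum_x chi (x * (x ^+ m - c)).

(** Substituting t x for x takes out t^(m+1), whose character is a sign and disappears in the
    square. *)
Lemma chi_sumZ (m : nat) (c t : F) : t != 0 ->
  chi_sum m (t ^+ m * c) ^+ 2 = chi_sum m c ^+ 2.
Proof.
move=> t0; have -> : chi_sum m (t ^+ m * c) = chi (t ^+ m.+1) * chi_sum m c.
  rewrite /chi_sum (@reindex_affine t 0) // mulr_sumr; apply: eq_bigr => x _.
  by rewrite -chiM exprS addr0 exprMn; congr chi; ring.
by rewrite exprMn chi_sqr expf_neq0 // mul1r.
Qed.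

(** Opening the square and summing over c first gives pair correlations at x^m and y^m. Their
    constant -1 contributes nothing because [sum_chi] is 0, so only pairs with x^m = y^m remain, at
    most [m] values of y for each nonzero x. *)
Lemma sum_chi_sum_sqr (m : nat) : (0 < m)%N ->
  \sum_c chi_sum m c ^+ 2 <= (#|F| * (#|F| - 1) * m)%:R.
Proof.
move=> m0.
have -> : \sum_c chi_sum m c ^+ 2 =
    \sum_x \sum_y chi (x * y) * ((x ^+ m == y ^+ m)%:R * #|F|%:R - 1).
  under eq_bigr => c _ do rewrite expr2 /chi_sum big_distrlr /=.
  rewrite exchange_big; apply: eq_bigr => x _ /=.
  rewrite exchange_big; apply: eq_bigr => y _ /=.
  rewrite -sum_chi_pair mulr_sumr; apply: eq_bigr => c _.
  by rewrite -!chiM; congr chi; ring.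
have -> : \sum_x \sum_y chi (x * y) * ((x ^+ m == y ^+ m)%:R * #|F|%:R - 1) =
    \sum_x \sum_y chi (x * y) * (x ^+ m == y ^+ m)%:R * #|F|%:R.
  apply: eq_bigr => x _.
  transitivity (\sum_y (chi (x * y) * (x ^+ m == y ^+ m)%:R * #|F|%:R - chi x * chi y)).
    by apply: eq_bigr => y _; rewrite chiM; ring.
  by rewrite sumrB -mulr_sumr sum_chi mulr0 subr0.
rewrite (bigD1 0) //= big1 ?add0r => [|y _]; last by rewrite mul0r chi0 !mul0r.
apply: (@le_trans _ _ (\sum_(x : F | x != 0) (m * #|F|)%:R)); last first.
  by rewrite sumr_const cardC1 -mulrnA ler_nat subn1 mulnC mulnA mulnAC
    [(#|F| * _)%N]mulnC.
apply: ler_sum => x x0.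
apply: (@le_trans _ _ (\sum_(y : F) (y ^+ m == x ^+ m)%:R * #|F|%:R)).
  apply: ler_sum => y _; apply: ler_wpM2r; first by [].
  rewrite eq_sym; case: eqP => _; rewrite ?mulr1n ?mulr0n ?mulr1 ?mulr0 //.
  exact: le_trans (ler_norm _) (normr_chi_le1 _).
rewrite -mulr_suml natrM; apply: ler_wpM2r; first by [].
rewrite -natr_sum ler_nat -big_mkcond sum1dep_card.
exact: card_expf_eq.
Qed.

(* By [chi_sumZ] every nonzero m-th power [c] contributes as much as [c = 1] to the
   second moment, and these make up at least a proportion 1 / m of the nonzero [c]. *)
Lemma chi_sum1_sqr (m : nat) : (0 < m)%N ->
  chi_sum m 1 ^+ 2 <= (m ^ 2 * #|F|)%:R.
Proof.
move=> m0; have q1 : 0 < (#|F| - 1)%:R :> int by have := card_gt3; lia.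
rewrite -(ler_pM2l q1).
have -> : (#|F| - 1)%:R * chi_sum m 1 ^+ 2 =
    \sum_(t | t != 0) chi_sum m (t ^+ m) ^+ 2.
  rewrite (eq_bigr (fun=> chi_sum m 1 ^+ 2)) => [|t t0].
    by rewrite sumr_const cardC1 subn1 mulr_natl.
  by rewrite -(chi_sumZ m 1 t0) mulr1.
have -> : (#|F| - 1)%:R * (m ^ 2 * #|F|)%:R = m%:R * (#|F| * (#|F| - 1) * m)%:R :> int.
  by rewrite -!natrM; congr _%:R; lia.
apply: le_trans (ler_wpM2l _ (sum_chi_sum_sqr m0)); last by [].
apply: (@le_trans _ _ (\sum_t chi_sum m (t ^+ m) ^+ 2)).
  by rewrite [leRHS](bigD1 0) //= lerDr sqr_ge0.
rewrite (eq_bigr (fun t => \sum_c (t ^+ m == c)%:R * chi_sum m c ^+ 2)).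
  rewrite exchange_big mulr_sumr; apply: ler_sum => c _ /=.
  rewrite -mulr_suml; apply: ler_wpM2r; first exact: sqr_ge0.
  rewrite -natr_sum ler_nat -big_mkcond sum1dep_card.
  exact: card_expf_eq.
move=> t _; rewrite (bigD1 (t ^+ m)) //= eqxx mul1r big1 ?addr0 // => c.
by rewrite eq_sym => /negbTE ->; rewrite mul0r.
Qed.

End QuadraticCharacter.

(** * Fourth moment over polynomials of degree at most 3 *)

Section FourthMoment.

Variable F : finFieldType.
Hypothesis q1mod4 : (#|F| %% 4 = 1)%N.

(** Row vectors encode the polynomials of degree at most 3 as a finite type, over which one can
    sum. *)
Definition ev (c : 'rV[F]_4) (x : F) : F := (rVpoly c).[x].

Lemma evD (c g : 'rV[F]_4) (k x : F) : ev (c + k *: g) x = ev c x + k * ev g x.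
Proof. by rewrite /ev linearD linearZ /= hornerD hornerZ. Qed.

Lemma interpolation (x : F) (s : seq F) : x \notin s -> (size s <= 3)%N ->
  exists g : 'rV[F]_4, ev g x = 1 /\ forall y, y \in s -> ev g y = 0.
Proof.
move=> xs s3; set p := \prod_(y <- s) ('X - y%:P).
have px : p.[x] != 0 by rewrite -rootE root_prod_XsubC.
exists (poly_rV (p.[x]^-1 *: p)); rewrite /ev poly_rV_K; last first.
  by rewrite size_scale ?invr_neq0 // size_prod_XsubC.
split=> [|y ys]; rewrite hornerZ ?mulVf //.
by move: ys; rewrite -root_prod_XsubC -/p => /rootP ->; rewrite mulr0.
Qed.

(* Multiplying the value at [x] by a nonsquare and keeping the values on [s]
   permutes the polynomials of degree at most 3 and changes the sign. *)
Lemma sum_chi_isolated (x : F) (s : seq F) : x \notin s -> (size s <= 3)%N ->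
  \sum_c chi (ev c x) * \prod_(y <- s) chi (ev c y) = 0.
Proof.
move=> xs s3; have [g [gx gs]] := interpolation xs s3.
have [u u0 chiu] := exists_nonsquare q1mod4.
pose h v (c : 'rV[F]_4) := c + ((v - 1) * ev c x) *: g.
have hK v w : v * w = 1 -> cancel (h v) (h w).
  move=> vw c; rewrite /h evD gx -addrA -scalerDl.
  have -> : (v - 1) * ev c x + (w - 1) * (ev c x + (v - 1) * ev c x * 1) =
            (v * w - 1) * ev c x by ring.
  by rewrite vw subrr mul0r scale0r addr0.
have hbij : bijective (h u).
  by exists (h u^-1); apply: hK; rewrite ?mulfV ?mulVf.
have : \sum_c chi (ev c x) * \prod_(y <- s) chi (ev c y) =
       - \sum_c chi (ev c x) * \prod_(y <- s) chi (ev c y).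
  rewrite {1}(reindex (h u)) /=; last exact: onW_bij.
  rewrite -sumrN; apply: eq_bigr => c _.
  have -> : ev (h u c) x = u * ev c x by rewrite evD gx; ring.
  rewrite chiM // chiu mulN1r mulNr; congr (- (_ * _)).
  by apply: eq_big_seq => y ys; rewrite evD gs // mulr0 addr0.
lia.
Qed.

Definition cubic_sum (c : 'rV[F]_4) : int := \sum_x chi (ev c x).

(** A point different from the other three makes the sum vanish by [sum_chi_isolated]. Otherwise the
    points coincide in pairs, some indicator is 1, and the trivial bound q^4 suffices. *)
Lemma fourth_correlation (x y z t : F) :
  \sum_c chi (ev c x) * chi (ev c y) * (chi (ev c z) * chi (ev c t)) <=
  (#|F| ^ 4)%:R * (((x == y) && (z == t))%:R + ((x == z) && (y == t))%:R +
                   ((x == t) && (y == z))%:R).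
Proof.
set L := leLHS; set b := (X in _ <= _ * X).
have b0 : 0 <= b by rewrite !addr_ge0.
have iso (x' y' z' t' : F) : 
    (forall c, chi (ev c x) * chi (ev c y) * (chi (ev c z) * chi (ev c t)) = 
      chi (ev c x') * \prod_(w <- [:: y'; z'; t']) chi (ev c w)) ->
    x' \notin [:: y'; z'; t'] -> L <= (#|F| ^ 4)%:R * b.
  move=> e n; rewrite /L (eq_bigr _ (fun c _ => e c)) sum_chi_isolated //.
  by rewrite mulr_ge0.
case: (boolP (x \in [:: y; z; t])) => [hx|]; last first.
  by apply: iso => c; rewrite !big_cons big_nil; ring.
case: (boolP (y \in [:: x; z; t])) => [hy|]; last first.
  by apply: iso => c; rewrite !big_cons big_nil; ring.
case: (boolP (z \in [:: x; y; t])) => [hz|]; last first.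
  by apply: iso => c; rewrite !big_cons big_nil; ring.
case: (boolP (t \in [:: x; y; z])) => [ht|]; last first.
  by apply: iso => c; rewrite !big_cons big_nil; ring.
have b1 : 1 <= b.
  rewrite /b; move: hx hy hz ht; rewrite !inE.
  rewrite [y == x]eq_sym [z == x]eq_sym [z == y]eq_sym [t == x]eq_sym.
  rewrite [t == y]eq_sym [t == z]eq_sym.
  by do 6 (case: eqP => ? //=); exfalso; congruence.
apply: (@le_trans _ _ (#|F| ^ 4)%:R); last by rewrite ler_peMr.
have -> : (#|F| ^ 4)%:R = \sum_(c : 'rV[F]_4) 1 :> int.
  by rewrite sumr_const card_mx mul1n.
apply: ler_sum => c _; apply: le_trans (ler_norm _) _.
by rewrite !normrM !mulr_ile1 ?mulr_ge0 ?normr_chi_le1.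
Qed.

Lemma sum_cubic_sum4 : \sum_c cubic_sum c ^+ 4 <= (3 * #|F| ^ 6)%:R.
Proof.
have -> : \sum_c cubic_sum c ^+ 4 = \sum_(p : F * F) \sum_(r : F * F)
   \sum_c chi (ev c p.1) * chi (ev c p.2) * (chi (ev c r.1) * chi (ev c r.2)).
  transitivity (\sum_c \sum_(p : F * F) \sum_(r : F * F)
   chi (ev c p.1) * chi (ev c p.2) * (chi (ev c r.1) * chi (ev c r.2))).
    apply: eq_bigr => c _; rewrite -big_distrlr /= -(pair_big xpredT xpredT
      (fun x y => chi (ev c x) * chi (ev c y))) /= -big_distrlr /=.
    by rewrite -/(cubic_sum c); ring.
  rewrite exchange_big; apply: eq_bigr => p _ /=.
  by rewrite exchange_big.
apply: le_trans (ler_sum _ (fun p _ => ler_sum _ (fun r _ =>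
  fourth_correlation p.1 p.2 r.1 r.2))) _.
under eq_bigr => p _ do rewrite -mulr_sumr 2!big_split /=.
rewrite -mulr_sumr 2!big_split /=.
have -> : \sum_(p : F * F) \sum_(r : F * F)
    ((p.1 == p.2) && (r.1 == r.2))%:R = (#|F| ^ 2)%:R :> int.
  have D : \sum_(p : F * F) (p.1 == p.2)%:R = #|F|%:R :> int.
    rewrite -(pair_big xpredT xpredT (fun x y => (x == y)%:R)) /=.
    rewrite -sumr_const; apply: eq_bigr => x _.
    by rewrite (bigD1 x) //= eqxx big1 ?addr0 // => y; rewrite eq_sym => /negbTE ->.
  rewrite expnS expn1 natrM -{1}D -{1}D big_distrlr /=.
  by apply: eq_bigr => p _; apply: eq_bigr => r _; rewrite -natrM mulnb.
(* In the two crossed pairings the second pair is determined by the first: it is the same pair or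
   the swapped one. *)
have E (f : F * F -> F * F) (B : F * F -> F * F -> bool) :
    (forall p r, B p r = (r == f p)) ->
    \sum_(p : F * F) \sum_(r : F * F) (B p r)%:R = (#|F| ^ 2)%:R :> int.
  move=> Bf; have -> : (#|F| ^ 2 = #|{: F * F}|)%N by rewrite card_prod expnS expn1.
  rewrite -sumr_const; apply: eq_bigr => p _.
  rewrite (bigD1 (f p)) //= Bf eqxx big1 ?addr0 // => r.
  by rewrite Bf => /negbTE ->.
rewrite (E id) => [|[x y] [z t]]; last first.
  by rewrite /= xpair_eqE [x == _]eq_sym [y == _]eq_sym.
rewrite (E (fun p => (p.2, p.1))) => [|[x y] [z t]]; last first.
  by rewrite /= xpair_eqE [x == _]eq_sym [y == _]eq_sym andbC.
rewrite -!natrD -natrM ler_nat leq_eqVlt; apply/orP; left; apply/eqP.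
rewrite -[6%N]/(4 + 2)%N expnD; move: (#|F| ^ 4)%N (#|F| ^ 2)%N => u v; lia.
Qed.

(** * The affine orbit of x(x - 1)(x - z) *)

Definition T3 (a b c : F) : int := \sum_x chi ((x - a) * (x - b) * (x - c)).

Lemma T3_affine (k s a b c : F) : k != 0 ->
  T3 (k * a + s) (k * b + s) (k * c + s) = chi k * T3 a b c.
Proof.
move=> k0; rewrite /T3 (reindex_affine s _ k0) mulr_sumr; apply: eq_bigr => x _.
have -> : (k * x + s - (k * a + s)) * (k * x + s - (k * b + s)) *
  (k * x + s - (k * c + s)) = k ^+ 2 * (k * ((x - a) * (x - b) * (x - c))) by ring.
by rewrite chi_sqrM // chiM.
Qed.

Section Orbit.

Variable z : F.
Hypothesis sqrz : z ^+ 2 = -1.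
Hypothesis char_neq5 : 5%:R != 0 :> F.

(** The roots are the images of 0, 1, z under x -> a x + b, and [d] is the leading coefficient. *)
Definition orbit_poly (p : F * F * F) : {poly F} := let: (d, a, b) := p in
  d *: (('X - b%:P) * ('X - (a + b)%:P) * ('X - (a * z + b)%:P)).

Lemma size_orbit_poly p : (size (orbit_poly p) <= 4)%N.
Proof.
case: p => [[d a] b]; apply: leq_trans (size_scale_leq _ _) _.
by rewrite size_mul ?mulf_neq0 ?polyXsubC_eq0 // size_mul ?polyXsubC_eq0 // !size_XsubC.
Qed.

Definition orbit_set : {set F * F * F} := [set p | (p.1.1 != 0) && (p.1.2 != 0)].

Lemma horner_orbit d a b x : (orbit_poly (d, a, b)).[x] =
  d * ((x - b) * (x - (a + b)) * (x - (a * z + b))).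
Proof. by rewrite /orbit_poly !hornerE. Qed.

(* The roots of a cubic in the orbit form an affine image of [{0, 1, z}], which
   has a nontrivial affine symmetry only when 5 = 0. *)
Lemma orbit_inj : {in orbit_set &, injective (fun p => poly_rV (orbit_poly p) : 'rV[F]_4)}.
Proof.
move=> [[d a] b] [[d' a'] b']; rewrite !inE /= => /andP[d0 a0] /andP[d'0 a'0].
move/(congr1 rVpoly); rewrite !poly_rV_K ?(size_orbit_poly (_, _, _)) //
  -/(orbit_poly (d, a, b)) -/(orbit_poly (d', a', b')) => E.
have dd : d = d'.
  move/(congr1 lead_coef): (E); rewrite /orbit_poly !lead_coefZ.
  by rewrite !lead_coefM !lead_coefXsubC !mulr1.
subst d'.
have e x : (x - b) * (x - (a + b)) * (x - (a * z + b)) =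
           (x - b') * (x - (a' + b')) * (x - (a' * z + b')).
  by apply: (mulfI d0); rewrite -!horner_orbit E.
have zz : z * z = -1 by rewrite -expr2.
have n2 := natf2_neq0 q1mod4.
(* Each factor below is nonzero because its product with a companion is -1, 2 or 5. *)
have norm_neq0 (w w' : F) : w * w' != 0 -> w != 0.
  by apply: contraNneq => ->; rewrite mul0r.
have nz : z != 0 by apply: (@norm_neq0 _ z); rewrite zz oppr_eq0 oner_eq0.
have n1z : 1 + z != 0.
  by apply: (@norm_neq0 _ (1 - z)); rewrite (_ : _ * _ = 2%:R) //; ring: zz.
have n1mz : 1 - z != 0.
  by apply: (@norm_neq0 _ (1 + z)); rewrite (_ : _ * _ = 2%:R) //; ring: zz.
have n12z : 1 + 2 * z != 0.
  by apply: (@norm_neq0 _ (1 - 2 * z)); rewrite (_ : _ * _ = 5%:R) //; ring: zz.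
have n1m2z : 1 - 2 * z != 0.
  by apply: (@norm_neq0 _ (1 + 2 * z)); rewrite (_ : _ * _ = 5%:R) //; ring: zz.
have absurd (w : F) (G : Prop) : w != 0 -> w * a = 0 -> G.
  by move=> w0 /eqP; rewrite mulf_eq0 (negbTE w0) (negbTE a0).
have roots x : (x - b) * (x - (a + b)) * (x - (a * z + b)) = 0 ->
    [\/ x = b, x = a + b | x = a * z + b].
  by move/eqP; rewrite !mulf_eq0 !subr_eq0 => /orP[/orP[]|] /eqP ->; constructor.
have r1 := roots b'; have r2 := roots (a' + b'); have r3 := roots (a' * z + b').
move: r1 r2 r3; rewrite !e !subrr !(mul0r, mulr0) => /(_ erefl) r1 /(_ erefl) r2 /(_ erefl) r3.
have {}r2 : [\/ a' = b - b', a' = a + b - b' | a' = a * z + b - b'].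
  by case: r2 => h; [constructor 1|constructor 2|constructor 3]; rewrite -h addrK.
have n1 : (1 : F) != 0 := oner_neq0 F.
have n2z : 2%:R * z != 0 by rewrite mulf_neq0.
have absurd_l w (l r : F) (G : Prop) : w != 0 -> w * a = l - r -> l = r -> G.
  by move=> w0 wE lr; apply: (absurd w) => //; rewrite wE lr subrr.
have absurd_r w (l r : F) (G : Prop) : w != 0 -> w * a = r - l -> l = r -> G.
  by move=> w0 wE lr; apply: (absurd w) => //; rewrite wE lr subrr.
(* Nine choices for the images of 0 and 1: equal images force [a'] to be 0, one choice is the
   identity, and in the others the image of z gives w a = 0 with [w] nonzero. *)
case: r1 => ?; subst b'; case: r2 => a'E; subst a'.
- by rewrite subrr eqxx in a'0.
- by rewrite addrK.
- by case: r3; [apply: (absurd_r (1 : F)) => //; ring: zz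
               | apply: (absurd_r (2%:R : F)) => //; ring: zz
               | apply: (absurd_r (1 + z)) => //; ring: zz].
- by case: r3; [apply: (absurd_l (1 - z)) => //; ring: zz
               | apply: (absurd_r z) => //; ring: zz
               | apply: (absurd_l (1 - 2 * z)) => //; ring: zz].
- by rewrite subrr eqxx in a'0.
- by case: r3; [apply: (absurd_r z) => //; ring: zz
               | apply: (absurd_r (1 + z)) => //; ring: zz
               | apply: (absurd_r (2%:R * z)) => //; ring: zz].
- by case: r3; [apply: (absurd_l (1 + z)) => //; ring: zz
               | apply: (absurd_l z) => //; ring: zz
               | apply: (absurd_l (1 : F)) => //; ring: zz].
- by case: r3; [apply: (absurd_l (1 + 2 * z)) => //; ring: zz
               | apply: (absurd_l (2%:R * z)) => //; ring: zz
               | apply: (absurd_l (1 + z)) => //; ring: zz].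
- by rewrite subrr eqxx in a'0.
Qed.

Lemma T3_orbit_bound : (#|F| - 1)%:R ^+ 2 * T3 0 1 z ^+ 4 <= 3 * #|F|%:R ^+ 5.
Proof.
have q0 : 0 < #|F|%:R :> int by rewrite ltr0n; have := card_gt3 q1mod4; lia.
(* The extra factor q counts the translations [b], so the left side becomes the part of the fourth
   moment carried by the orbit. *)
rewrite -(ler_pM2l q0).
have -> : #|F|%:R * (3 * #|F|%:R ^+ 5) = (3 * #|F| ^ 6)%:R :> int.
  by rewrite natrM natrX; ring.
apply: le_trans sum_cubic_sum4.
have -> : #|F|%:R * ((#|F| - 1)%:R ^+ 2 * T3 0 1 z ^+ 4) =
    \sum_(p in orbit_set) cubic_sum (poly_rV (orbit_poly p)) ^+ 4.
  rewrite (eq_bigr (fun=> T3 0 1 z ^+ 4)).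
    have -> : orbit_set = setX (setX [set~ 0] [set~ 0]) [set: F].
      by apply/setP => -[[d a] b]; rewrite !inE andbT.
    rewrite sumr_const !cardsX cardsT cardsC1 -[RHS]mulr_natl !natrM subn1; ring.
  move=> [[d a] b]; rewrite inE /= => /andP[d0 a0].
  have -> : cubic_sum (poly_rV (orbit_poly (d, a, b))) = chi d * chi a * T3 0 1 z.
    rewrite -mulrA -(T3_affine b 0 1 z a0) /T3 mulr_sumr.
    apply: eq_bigr => x _; rewrite /ev poly_rV_K ?size_orbit_poly // horner_orbit.
    by rewrite mulr0 mulr1 add0r chiM.
  rewrite !exprMn (exprM _ 2 2) chi_sqr d0 expr1n mul1r.
  by rewrite (exprM _ 2 2) chi_sqr a0 expr1n mul1r.
rewrite -(big_imset (fun c => cubic_sum c ^+ 4) orbit_inj) /=.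
rewrite [leRHS](bigID (mem ((fun p => poly_rV (orbit_poly p)) @: orbit_set))) /=.
by rewrite lerDl sumr_ge0 // => c _; rewrite (exprM _ 2 2) sqr_ge0.
Qed.

End Orbit.
End FourthMoment.

(** * Character sums over subsets of the five points *)

Section FivePoints.

Variable F : finFieldType.
Hypothesis q1mod4 : (#|F| %% 4 = 1)%N.
Variable z : F.
Hypothesis sqrz : z ^+ 2 = -1.

Definition T4 (a b c d : F) : int :=
  \sum_x chi ((x - a) * (x - b) * (x - c) * (x - d)).

(** Four factors bring out k^4, a square, so unlike for [T3] no sign appears. *)
Lemma T4_affine (k s a b c d : F) : k != 0 ->
  T4 (k * a + s) (k * b + s) (k * c + s) (k * d + s) = T4 a b c d.
Proof.
move=> k0; rewrite /T4 (reindex_affine s _ k0); apply: eq_bigr => x _.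
have -> : (k * x + s - (k * a + s)) * (k * x + s - (k * b + s)) *
  (k * x + s - (k * c + s)) * (k * x + s - (k * d + s)) =
  (k ^+ 2) ^+ 2 * ((x - a) * (x - b) * (x - c) * (x - d)) by ring.
by rewrite chi_sqrM // expf_neq0.
Qed.

(* The substitution [x = 1 / u] moves the root 0 to infinity. *)
Lemma T4_inversion (a b c : F) : a != 0 -> b != 0 -> c != 0 ->
  T4 0 a b c = chi (a * b * c) * T3 a^-1 b^-1 c^-1 - 1.
Proof.
move=> a0 b0 c0; rewrite /T4 /T3 (bigD1 0) //= subr0 !mul0r chi0 add0r.
rewrite (reindex_inj invr_inj) /=.
(* The term at 0 of the [T3] sum has no counterpart on the left; it equals chi(-1) = 1, whence the
   -1. *)
rewrite [in RHS](bigD1 0) //= !sub0r mulrDr -chiM //.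
have -> : a * b * c * (- a^-1 * - b^-1 * - c^-1) = -1.
  by field; rewrite a0 b0 c0.
rewrite chiN // chi1 addrAC subrr add0r mulr_sumr.
apply: eq_big => [x|x]; rewrite invr_eq0 // => x0.
have -> : (x^-1 - 0) * (x^-1 - a) * (x^-1 - b) * (x^-1 - c) =
   (x ^- 2) ^+ 2 * - ((a * b * c) * ((x - a^-1) * (x - b^-1) * (x - c^-1))).
  by field; rewrite a0 b0 c0 x0.
by rewrite chi_sqrM ?invr_eq0 ?expf_neq0 // chiN // chiM.
Qed.

Lemma T3_eq (k s a b c a' b' c' : F) : k != 0 ->
  a' = k * a + s -> b' = k * b + s -> c' = k * c + s ->
  T3 a' b' c' = chi k * T3 a b c.
Proof. by move=> k0 -> -> ->; apply: T3_affine. Qed.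

Lemma T3_swap12 (a b c : F) : T3 b a c = T3 a b c.
Proof. by apply: eq_bigr => x _; congr chi; ring. Qed.

Lemma T3_swap23 (a b c : F) : T3 a c b = T3 a b c.
Proof. by apply: eq_bigr => x _; congr chi; ring. Qed.

Let A : int := chi_sum 2 (1 : F).
Let B := T3 0 1 z.
Let e := chi z.
Let d := chi (1 - z).

Let z0 : z != 0.
Proof. by apply: contra_eq_neq sqrz => ->; rewrite expr0n eq_sym oppr_eq0 oner_eq0. Qed.

Let zz : z * z = -1. Proof. by rewrite -expr2. Qed.

Let N10 : -1 != 0 :> F. Proof. by rewrite oppr_eq0 oner_eq0. Qed.

Let z1 : z != 1.
Proof. by apply: contra_eq_neq sqrz => ->; rewrite expr1n (oner_neqN1 q1mod4). Qed.

Let zN1 : z != -1.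
Proof. by apply: contra_eq_neq sqrz => ->; rewrite sqrrN expr1n (oner_neqN1 q1mod4). Qed.

Let ee : e * e = 1. Proof. by rewrite -expr2 chi_sqr z0. Qed.

Lemma T3A : T3 (0 : F) 1 (-1) = A.
Proof. by apply: eq_bigr => x _; congr chi; ring. Qed.

Lemma T3_0z_Nz : T3 0 z (- z) = e * A.
Proof. by rewrite -T3A; apply: (@T3_eq _ 0) => //; ring. Qed.

Lemma T3_01Nz : T3 0 1 (- z) = e * B.
Proof.
rewrite /e -(chiN q1mod4) /B -T3_swap23.
by apply: (@T3_eq _ 0); rewrite ?oppr_eq0 //; ring: zz.
Qed.

Lemma T3_0N1z : T3 0 (-1) z = e * B.
Proof. by rewrite /B -T3_swap23; apply: (@T3_eq _ 0) => //; ring: zz. Qed.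

Lemma T3N (a b c : F) : T3 (- a) (- b) (- c) = T3 a b c.
Proof.
rewrite (@T3_eq (-1) 0 a b c) ?chiN ?chi1 ?mul1r //; ring.
Qed.

Lemma T3_0N1Nz : T3 0 (-1) (- z) = B.
Proof. by rewrite -[0]oppr0 T3N. Qed.

(** The map x -> (1 - z) x + z takes 0, 1, -z to z, 1, -1. *)
Lemma T3_1N1z : T3 1 (-1) z = d * (e * B).
Proof.
rewrite -T3_01Nz -(T3_swap12 0) -(T3_swap23 1 0).
apply: (@T3_eq _ z); first by rewrite subr_eq0 eq_sym.
all: ring: zz.
Qed.

Lemma T3_1N1Nz : T3 1 (-1) (- z) = d * (e * B).
Proof. by rewrite -T3_1N1z -[RHS]T3_swap12 -[RHS]T3N opprK. Qed.

Lemma T3_1zNz : T3 1 z (- z) = d * B.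
Proof.
have -> : d * B = e * (d * (e * B)) by rewrite mulrCA (mulrA e) ee mul1r.
rewrite -T3_1N1Nz (T3_swap23 1 (- z) (-1)) (T3_swap12 (- z) 1 (-1)).
by apply: (@T3_eq _ 0) => //; ring: zz.
Qed.

Lemma T3_N1zNz : T3 (-1) z (- z) = d * B.
Proof. by rewrite -T3_1zNz -T3_swap23 -[RHS]T3N opprK. Qed.

Lemma T4_01N1z : T4 0 1 (-1) z = d * B - 1.
Proof.
rewrite T4_inversion ?oner_eq0 // mulrN1 mulNr mul1r chiN // invr1 invrN1.
have -> : z^-1 = - z by apply: (mulfI z0); rewrite mulfV // mulrN zz opprK.
by rewrite T3_1N1Nz -/e mulrCA (mulrA e) ee mul1r.
Qed.

Lemma T4_scale0 (k a b c a' b' c' : F) : k != 0 ->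
  a' = k * a -> b' = k * b -> c' = k * c -> T4 0 a' b' c' = T4 0 a b c.
Proof. by move=> k0 -> -> ->; rewrite -(T4_affine 0 0 a b c k0) mulr0 !addr0. Qed.

Lemma T4_01N1Nz : T4 0 1 (-1) (- z) = d * B - 1.
Proof.
rewrite -T4_01N1z.
have -> : T4 0 1 (-1) (- z) = T4 0 (-1) 1 z.
  by apply: (@T4_scale0 (-1)) => //; ring.
by apply: eq_bigr => x _; congr chi; ring.
Qed.

Lemma T4_01zNz : T4 0 1 z (- z) = d * B - 1.
Proof.
rewrite -T4_01N1Nz.
have -> : T4 0 1 z (- z) = T4 0 (- z) 1 (-1).
  by apply: (@T4_scale0 z) => //; ring: zz.
by apply: eq_bigr => x _; congr chi; ring.
Qed.

Lemma T4_0N1zNz : T4 0 (-1) z (- z) = d * B - 1.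
Proof.
rewrite -T4_01N1z.
have -> : T4 0 (-1) z (- z) = T4 0 z 1 (-1).
  by apply: (@T4_scale0 z) => //; ring: zz.
by apply: eq_bigr => x _; congr chi; ring.
Qed.

Lemma T4_1N1zNz : T4 1 (-1) z (- z) = A - 1.
Proof.
have n2 := natf2_neq0 q1mod4.
have h1 : z - 1 != 0 by rewrite subr_eq0.
have h2 : - z - 1 != 0 by rewrite -opprD oppr_eq0 addr_eq0.
have -> : T4 1 (-1) z (- z) = T4 0 (- 2%:R) (z - 1) (- z - 1).
  rewrite -(@T4_affine 1 1 0 (- 2%:R) (z - 1) (- z - 1)) ?oner_eq0 //.
  by congr T4; ring.
rewrite T4_inversion ?oppr_eq0 //.
have -> : - 2%:R * (z - 1) * (- z - 1) = - (2%:R * 2%:R) by ring: zz.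
rewrite chiN // chiM // -expr2 chi_sqr n2 mul1r; congr (_ - 1).
(* Since 2z = (1 + z)^2, the elements 2 and z have the same character. *)
have chi2 : chi (2%:R : F) = e.
  have : chi (2%:R * z) = 1.
    rewrite (_ : 2%:R * z = (1 + z) * (1 + z)); last by ring: zz.
    by rewrite chiM // -expr2 chi_sqr addrC addr_eq0 zN1.
  by rewrite chiM // -/e => h; rewrite -[LHS]mulr1 -ee mulrA h mul1r.
(* The three reciprocals are the images of 0, 1, -1 under x -> -(z x + 1)/2. *)
rewrite (@T3_eq (- z * 2^-1) (- 2^-1) 0 1 (-1)) ?mulf_neq0 ?oppr_eq0 ?invr_eq0 //.
- by rewrite T3A chiM // chiN // chiV // chi2 -/e ee mul1r.
- by rewrite mulr0 add0r invrN.
- by apply: (mulfI h1); rewrite mulfV //; field: zz.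
- by apply: (mulfI h2); rewrite mulfV //; field: zz.
Qed.

Lemma T5E : \sum_x chi (x * (x - 1) * (x + 1) * (x - z) * (x + z)) = chi_sum 4 (1 : F).
Proof. by apply: eq_bigr => x _; congr chi; ring: zz. Qed.

Definition five_product (x : F) : int :=
  (1 - chi x) * (1 - chi (x - 1)) * (1 - chi (x + 1)) *
  (1 - chi (x - z)) * (1 - chi (x + z)).

(** The constant -15 collects -1 from each of the ten pairs and each of the five quadruples. The
    triples contribute -(1 + e) A - 2(1 + e)(1 + d) B, the quadruples A + 4 d B. *)
Lemma sum_five_product : \sum_x five_product x =
  #|F|%:R - 15 - e * A + (4 * d - 2 * (1 + e) * (1 + d)) * B - chi_sum 4 (1 : F).
Proof.
have pair (a b : F) : a != b -> \sum_x chi ((x - a) * (x - b)) = -1.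
  by move=> /negbTE ab; rewrite sum_chi_pair // ab mul0r sub0r.
have one (a : F) : \sum_x chi (x - a) = 0.
  by rewrite -[RHS](sum_chi q1mod4) [RHS](reindex_inj (addIr (- a))).
have N1 := oner_neqN1 q1mod4.
have zNz : z != - z.
  by rewrite -addr_eq0 -mulr2n -mulr_natl mulf_neq0 // (natf2_neq0 q1mod4).
rewrite -T5E.
transitivity (\sum_x (1 - (chi (x - 0) + chi (x - 1) + chi (x - -1) + chi (x - z) + chi (x - - z))
 + (chi ((x - 0) * (x - 1)) + chi ((x - 0) * (x - -1)) + chi ((x - 0) * (x - z))
    + chi ((x - 0) * (x - - z)) + chi ((x - 1) * (x - -1)) + chi ((x - 1) * (x - z))
    + chi ((x - 1) * (x - - z)) + chi ((x - -1) * (x - z)) + chi ((x - -1) * (x - - z))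
    + chi ((x - z) * (x - - z)))
 - (chi ((x - 0) * (x - 1) * (x - -1)) + chi ((x - 0) * (x - 1) * (x - z))
    + chi ((x - 0) * (x - 1) * (x - - z)) + chi ((x - 0) * (x - -1) * (x - z))
    + chi ((x - 0) * (x - -1) * (x - - z)) + chi ((x - 0) * (x - z) * (x - - z))
    + chi ((x - 1) * (x - -1) * (x - z)) + chi ((x - 1) * (x - -1) * (x - - z))
    + chi ((x - 1) * (x - z) * (x - - z)) + chi ((x - -1) * (x - z) * (x - - z)))
 + (chi ((x - 0) * (x - 1) * (x - -1) * (x - z)) + chi ((x - 0) * (x - 1) * (x - -1) * (x - - z))
    + chi ((x - 0) * (x - 1) * (x - z) * (x - - z)) + chi ((x - 0) * (x - -1) * (x - z) * (x - - z))
    + chi ((x - 1) * (x - -1) * (x - z) * (x - - z)))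
 - chi (x * (x - 1) * (x + 1) * (x - z) * (x + z)))).
  apply: eq_bigr => x _; rewrite /five_product !opprK subr0 !chiM //; ring.
have e3 (a b c : F) : \sum_x chi ((x - a) * (x - b) * (x - c)) = T3 a b c by [].
have e4 (a b c d' : F) :
  \sum_x chi ((x - a) * (x - b) * (x - c) * (x - d')) = T4 a b c d' by [].
have p1 : 0 != 1 :> F by rewrite eq_sym oner_eq0.
have p2 : 0 != -1 :> F by rewrite eq_sym.
have p3 : 0 != z by rewrite eq_sym.
have p4 : 0 != - z by rewrite eq_sym oppr_eq0.
have p5 : 1 != z by rewrite eq_sym.
have p6 : 1 != - z by rewrite -eqr_oppLR eq_sym.
have p7 : -1 != z by rewrite eq_sym.
have p8 : -1 != - z by rewrite eqr_opp.
rewrite !(sumrB, big_split) /= !one !pair // !e3 !e4.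
rewrite sumr_const T3A -/B T3_01Nz T3_0N1z T3_0N1Nz T3_0z_Nz T3_1N1z T3_1N1Nz T3_1zNz T3_N1zNz.
rewrite T4_01N1z T4_01N1Nz T4_01zNz T4_0N1zNz T4_1N1zNz.
ring.
Qed.

End FivePoints.

(* In characteristic 5 the orbit map is not injective, but there [0, 1, z] is an
   arithmetic progression up to order, so the sum equals [chi_sum 2 1] up to sign. *)
Lemma T3_01z_bound (F : finFieldType) (z : F) :
  (#|F| %% 4 = 1)%N -> (5 < #|F|)%N -> z ^+ 2 = -1 ->
  (#|F| - 1)%:R ^+ 2 * T3 0 1 z ^+ 4 <= 3 * #|F|%:R ^+ 5.
Proof.
move=> q1mod4 q5 sqrz; have [h5|] := eqVneq (5%:R : F) 0; last exact: T3_orbit_bound.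
have zz : z * z = -1 by rewrite -expr2.
have z0 : z != 0 by apply: contra_eq_neq sqrz => ->; rewrite expr0n eq_sym oppr_eq0 oner_eq0.
have BA : T3 0 1 z ^+ 2 = chi_sum 2 (1 : F) ^+ 2.
  rewrite -T3A.
  (* This forces z = 1/2 or z = 2, so that 0, z, 1 or 0, 1, z is a progression. *)
  have : (1 - 2%:R * z) * (1 + 2%:R * z) == 0.
    have -> : (1 - 2%:R * z) * (1 + 2%:R * z) = 5%:R by ring: zz.
    by rewrite h5.
  rewrite mulf_eq0 => /orP[] /eqP h.
    have zE : z = 1 - z by rewrite -[LHS]addr0 -h; ring.
    have -> : T3 0 1 z = chi z * T3 (-1) 1 (0 : F).
      by apply: (@T3_eq _ q1mod4 z z) => //; [ring | rewrite {2}zE; ring | ring].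
    rewrite exprMn chi_sqr z0 mul1r; congr (_ ^+ 2).
    by rewrite T3_swap23 T3_swap12 T3_swap23.
  have zE : z = 1 + 1.
    have : z - (1 + 1) = 5%:R * z - 2%:R * (1 + 2%:R * z) by ring.
    by rewrite h5 h mul0r mulr0 subrr => /eqP; rewrite subr_eq0 => /eqP.
  have -> : T3 0 1 z = chi (1 : F) * T3 (-1) 0 (1 : F).
    by apply: (@T3_eq _ q1mod4 1 1) => //; rewrite ?oner_eq0 // ?zE; ring.
  by rewrite chi1 mul1r T3_swap12 T3_swap23.
have A2 := chi_sum1_sqr q1mod4 (isT : (0 < 2)%N).
rewrite (exprM _ 2 2) BA.
move: (chi_sum _ _ ^+ 2) (sqr_ge0 (chi_sum 2 (1 : F))) A2 => X X0.
rewrite natrM natrB; last exact: leq_trans q5; move: q5.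
rewrite -(ler_nat int).
move: (#|F|%:R) => q q5 X4.
have {}X4 : X ^+ 2 <= (4 * q) ^+ 2 by apply: lerXn2r; rewrite ?nnegrE; lia.
have u0 := sqr_ge0 (q - 1).
have u1 : (q - 1) ^+ 2 <= q ^+ 2 by apply: lerXn2r; rewrite ?nnegrE; lia.
apply: le_trans (ler_pM u0 (sqr_ge0 _) u1 X4) _.
(* It remains to see that 16 <= 3q, which follows from q > 5. *)
have -> : q ^+ 2 * (4 * q) ^+ 2 = q ^+ 4 * 16 by ring.
have -> : 3 * q ^+ 5 = q ^+ 4 * (3 * q) by ring.
by apply: ler_wpM2l; [rewrite exprn_ge0|]; lia.
Qed.

(** * Numerical estimates and conclusion *)

Lemma error_bound (q a b s : int) : 2809 < q -> 0 <= a -> 0 <= b -> 0 <= s ->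
  a ^+ 2 <= 4 * q -> s ^+ 2 <= 16 * q -> (q - 1) ^+ 2 * b ^+ 4 <= 3 * q ^+ 5 ->
  80 < q - 15 - a - 4 * b - s.
Proof.
move=> q0 a0 b0 s0 ha hs hb; rewrite ltNge; apply/negP => H.
(* Here 2809 = 53^2, so sqrt q is at most q/53. *)
have ha' : 53 * a <= 2 * q by nia.
have hs' : 53 * s <= 4 * q by nia.
have hq : q <= 5 * b by lia.
have h4 : q ^+ 4 <= (5 * b) ^+ 4 by apply: lerXn2r; rewrite ?nnegrE; lia.
(* With 1875 = 3 * 5^4, cancelling q^4 leaves (q - 1)^2 <= 1875 q, impossible for q > 2809. *)
have : q ^+ 4 * (q - 1) ^+ 2 <= q ^+ 4 * (1875 * q).
  have -> : q ^+ 4 * (1875 * q) = 625 * (3 * q ^+ 5) by ring.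
  apply: le_trans (ler_wpM2r (sqr_ge0 _) h4) _.
  have -> : (5 * b) ^+ 4 * (q - 1) ^+ 2 = 625 * ((q - 1) ^+ 2 * b ^+ 4) by ring.
  exact: ler_wpM2l.
rewrite ler_pM2l; last by rewrite exprn_gt0; lia.
nia.
Qed.

(* The five points themselves each contribute at most 16, since one factor is 1
   there; any other point contributes 0 unless all five values are -1. *)
Lemma five_product_le (F : finFieldType) (z x : F) :
  five_product z x <= 16 * ((x == 0) + (x == 1) + (x == -1) + (x == z) + (x == - z))%:R \/
  [/\ chi x = -1, chi (x - 1) = -1, chi (x + 1) = -1, chi (x - z) = -1 & chi (x + z) = -1].
Proof.
have key (b : bool) (u : F) : (u == 0) = b ->
    [\/ b /\ chi u = 0, chi u = 1 | chi u = -1].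
  case: b => [/eqP ->|/negbT/chi_pm []]; first by rewrite chi0; constructor.
    by constructor 2. by constructor 3.
rewrite /five_product.
have k1 := key _ _ (erefl (x == 0)).
have k2 := key _ (x - 1) (subr_eq0 _ _).
have k3 := key _ (x + 1) (addr_eq0 _ _).
have k4 := key _ (x - z) (subr_eq0 _ _).
have k5 := key _ (x + z) (addr_eq0 _ _).
move: (x == 0) (x == 1) (x == -1) (x == z) (x == - z) k1 k2 k3 k4 k5.
move: (chi x) (chi (x - 1)) (chi (x + 1)) (chi (x - z)) (chi (x + z)).
move=> c1 c2 c3 c4 c5 b1 b2 b3 b4 b5.
have pos n : 0 <= 16 * n%:R :> int by rewrite mulr_ge0.
do 5 (case=> [[-> ->]|->|->];
  try by left; rewrite subrr !(mul0r, mulr0) pos).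
all: by [right | left; lia].
Qed.

Lemma sum_points (F : finFieldType) (z : F) :
  \sum_x ((x == 0) + (x == 1) + (x == -1) + (x == z) + (x == - z))%:R = 5%:R :> int.
Proof.
have p (a : F) : \sum_x (x == a)%:R = 1 :> int.
  by rewrite (bigD1 a) //= eqxx big1 ?addr0 // => x /negbTE ->.
rewrite (eq_bigr (fun x => (x == 0)%:R + (x == 1)%:R + (x == -1)%:R +
  (x == z)%:R + (x == - z)%:R)) => [|x _]; last by rewrite !natrD.
by rewrite !big_split /= !p.
Qed.

Lemma Cpot5 (F : finFieldType) (z a : F) : z ^+ 2 = -1 -> a \in Cpot F 5 ->
  [\/ a = 0, a = 1, a = -1 | a = z \/ a = - z].
Proof.
move=> sqrz; rewrite inE /kpotent -subr_eq0.
have -> : a ^+ 5 - a = a * (a - 1) * (a + 1) * (a - z) * (a + z).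
  by rewrite -[RHS]addr0; ring: sqrz.
rewrite !mulf_eq0 !subr_eq0 !addr_eq0.
by case/orP=> [/orP[/orP[/orP[]|]|]|] /eqP ->;
  [constructor 1|constructor 2|constructor 3|constructor 4; left|constructor 4; right].
Qed.

(** Cancelling a nonzero [b] from b^(1+(q-1)/2) = b leaves Euler's criterion. *)
Lemma Cpot_square (F : finFieldType) (b : F) : (#|F| %% 4 = 1)%N ->
  b \in Cpot F (1 + (#|F| - 1) %/ 2) -> chi b != -1.
Proof.
move=> q1mod4; rewrite inE /kpotent /chi add1n exprS divn2.
have [//|b0] := eqVneq b 0.
by rewrite -[X in _ == X]mulr1 (inj_eq (mulfI b0)) => ->.
Qed.

(* F_q is modelled as an arbitrary finite field F with q = #|F|. *)
Theorem theorem2p3 (F : finFieldType) :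
  (#|F| %% 4 = 1)%N -> (2809 < #|F|)%N ->
  let n := (1 + (#|F| - 1) %/ 2)%N in
  exists x : F, ~ (exists alpha beta : F,
    [/\ alpha \in Cpot F 5, beta \in Cpot F n & x = alpha + beta]).
Proof.
move=> q1mod4 qbig n; have [z sqrz] := exists_sqrtN1 q1mod4.
have z0 : z != 0 by apply: contra_eq_neq sqrz => ->; rewrite expr0n eq_sym oppr_eq0 oner_eq0.
suff [x [h0 h1 hN1 hz hNz]] : exists x : F, [/\ chi x = -1, chi (x - 1) = -1,
    chi (x + 1) = -1, chi (x - z) = -1 & chi (x + z) = -1].
  exists x => -[a [b [/(Cpot5 sqrz) ha /(Cpot_square q1mod4) hb xE]]].
  have {xE}bE : b = x - a by rewrite xE addrC addKr.
  move: hb; rewrite bE; case: ha => [->|->|->|[->|->]];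
    by rewrite ?subr0 ?opprK ?h0 ?h1 ?hN1 ?hz ?hNz.
pose P (x : F) := [&& chi x == -1, chi (x - 1) == -1, chi (x + 1) == -1,
  chi (x - z) == -1 & chi (x + z) == -1].
case: (pickP P) => [x /and5P[/eqP ? /eqP ? /eqP ? /eqP ? /eqP ?]|noP]; first by exists x.
(* Without such an x, only the five points contribute, at most 16 each; [error_bound] contradicts
   this. *)
have : \sum_x five_product z x <= 80.
  rewrite (_ : 80 = 16 * 5) // -(sum_points z) mulr_sumr; apply: ler_sum => x _.
  case: (five_product_le z x) => // -[c1 c2 c3 c4 c5].
  by have := noP x; rewrite /P c1 c2 c3 c4 c5.
rewrite sum_five_product // leNgt => /negP[].
have hA := chi_sum1_sqr q1mod4 (isT : (0 < 2)%N).
have hS := chi_sum1_sqr q1mod4 (isT : (0 < 4)%N).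
have hB := T3_01z_bound q1mod4 (leq_trans (isT : (5 < 2810)%N) qbig) sqrz.
move: hA hS hB; set A := chi_sum _ _; set S := chi_sum _ _; set B := T3 _ _ _ => hA hS hB.
have d0 : 1 - z != 0.
  by rewrite subr_eq0 eq_sym; apply: contra_eq_neq sqrz => ->; rewrite expr1n
    (oner_neqN1 q1mod4).
have qZ : 2809 < #|F|%:R :> int by rewrite (ltr_nat int 2809).
apply: lt_le_trans (@error_bound #|F|%:R `|A| `|B| `|S| qZ _ _ _ _ _ _) _ => //.
- by rewrite real_normK ?num_real // (le_trans hA) // natrM.
- by rewrite real_normK ?num_real // (le_trans hS) // natrM.
- rewrite (exprM _ 2 2) real_normK ?num_real // -exprM.
  by move: hB; rewrite natrB // ltnW // (leq_trans _ qbig).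
(* For each of the four sign choices the coefficient of [B] is 4 or -4. *)
by case: (chi_pm z0) => ->; case: (chi_pm d0) => ->; lia.
Qed.
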